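(* Let $f:\mathbb{R}^n\to\mathbb{R}$ be a measurable symmetric function, $\mathbf F\in\mathcal M^n$ and $\Lambda\in\mathcal Q_n$. Then $\mathcal D_f(\mathbf F)\subset\mathcal D_f(\Lambda\mathbf F)$. In particular, $\mathcal D_n(\mathbf F)\subset\mathcal D_n(\Lambda\mathbf F)$.
   Context: Work on an atomless probability space. $\mathcal M$ is the set of cdfs on $\mathbb{R}$; $X\sim F$ means $X$ has cdf $F$. A function $f$ is symmetric if $f(\mathbf x)=f(\pi(\mathbf x))$ for all $\mathbf x\in\mathbb{R}^n$ and all permutations $\pi$. For $\mathbf F=(F_1,\dots,F_n)\in\mathcal M^n$: $\mathcal D_f(\mathbf F)=\{\text{cdf of } f(X_1,\dots,X_n): X_i\sim F_i,\ i=1,\dots,n\}$, and $\mathcal D_n(\mathbf F)$ is $\mathcal D_f(\mathbf F)$ with $f(x_1,\dots,x_n)=x_1+\dots+x_n$. $\mathcal Q_n$ is the set of $n\times n$ doubly stochastic matrices (nonnegative entries, every row and column sums to 1). For $\Lambda=(\Lambda_{ij})\in\mathcal Q_n$, $\Lambda\mathbf F$ is the tuple whose $i$-th component is the cdf $\sum_{j=1}^n\Lambda_{ij}F_j$ (distribution mixture). *)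

(* Defs.v *)
From HB Require Import structures.
From mathcomp Require Import all_boot all_order all_algebra all_fingroup.
From mathcomp Require Import all_classical all_reals all_analysis.
Set Implicit Arguments. Unset Strict Implicit. Unset Printing Implicit Defensive.
Import Order.TTheory GRing.Theory Num.Theory.
Import numFieldNormedType.Exports.
Local Open Scope classical_set_scope.
Local Open Scope ring_scope.

Definition atomless d (T : measurableType d) (R : realType)
  (P : probability T R) : Prop :=
  forall A : set T, measurable A -> (0 < P A)%E ->
    exists B : set T, [/\ measurable B, B `<=` A, (0 < P B)%E & (P B < P A)%E].

Definition is_cdf (R : realType) (F : R -> R) : Prop :=
  [/\ {homo F : x y / x <= y},
      (forall x : R, (F y @[y --> x^'+] --> F x)),
      (F x @[x --> -oo] --> (0 : R))
    & (F x @[x --> +oo] --> (1 : R))].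

Definition cdf_of d (T : measurableType d) (R : realType)
  (P : probability T R) (Y : T -> R) : R -> R :=
  fun r => fine (P [set w | Y w <= r]).

Definition has_cdf d (T : measurableType d) (R : realType)
  (P : probability T R) (X : T -> R) (F : R -> R) : Prop :=
  measurable_fun setT X /\ cdf_of P X = F.

Definition symmetric_fun (R : realType) (n : nat) (f : n.-tuple R -> R) : Prop :=
  forall (x : n.-tuple R) (s : 'S_n), f x = f [tuple tnth x (s i) | i < n].

Definition Dset d (T : measurableType d) (R : realType) (P : probability T R)
  (n : nat) (f : n.-tuple R -> R) (F : 'I_n -> R -> R) : set (R -> R) :=
  [set G | exists X : 'I_n -> T -> R,
     (forall i, has_cdf P (X i) (F i)) /\
     G = cdf_of P (fun w => f [tuple X i w | i < n])].

Definition sumf (R : realType) (n : nat) (x : n.-tuple R) : R :=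
  \sum_(i < n) tnth x i.

Definition Dsum d (T : measurableType d) (R : realType) (P : probability T R)
  (n : nat) (F : 'I_n -> R -> R) : set (R -> R) :=
  Dset P (@sumf R n) F.

Definition doubly_stochastic (R : realType) (n : nat) (L : 'M[R]_n) : Prop :=
  [/\ forall i j, 0 <= L i j,
      forall i, \sum_(j < n) L i j = 1
    & forall j, \sum_(i < n) L i j = 1].

Definition mixF (R : realType) (n : nat) (L : 'M[R]_n) (F : 'I_n -> R -> R)
  : 'I_n -> R -> R :=
  fun i x => \sum_(j < n) L i j * F j x.

(* Main.v *)
Require Import Defs.
From HB Require Import structures.
From mathcomp Require Import all_boot all_order all_algebra all_fingroup.
From mathcomp Require Import all_classical all_reals all_analysis.
From mathcomp Require Import measurable_realfun lra.
Set Implicit Arguments. Unset Strict Implicit. Unset Printing Implicit Defensive.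
Import Order.TTheory GRing.Theory Num.Theory.
Import numFieldNormedType.Exports.

(* By Birkhoff's theorem L is a convex combination, with weights [c s], of
   permutation matrices. If (X_1, .., X_n) has marginals F, the mixture with
   weights [c s] of the laws of (X_{s 1}, .., X_{s n}) has marginals LF, and by
   symmetry it gives f the law of f(X). It remains to realise this mixture on
   the given space, where no randomisation independent of X need exist: X may
   generate the whole sigma-algebra. A vector of reals is encoded by the
   sequence of bits [x_i <= q], q rational, and any law on bit sequences is
   realised by a dyadic tree of events whose successive splittings are given by
   Sierpinski's theorem on atomless measures. *)

(** * Hall's marriage theorem and Birkhoff's theorem *)

(** Induction on the size of [A]. The set [A] and the neighbourhoods [e] both vary, since the
    induction removes vertices on either side; [u0] is the value of the matching when [A] is
    empty. *)
Lemma hall_marriage (T U : finType) (u0 : U) (e : T -> {set U}) (A : {set T}) :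
  (forall S : {set T}, S \subset A -> #|S| <= #|\bigcup_(i in S) e i|)%N ->
  exists f : T -> U,
    {in A &, injective f} /\ {in A, forall i, f i \in e i}.
Proof.
have [m] := ubnP #|A|; elim: m e A => // m IH e A; rewrite ltnS => leAm hallA.
pose N (S : {set T}) := (\bigcup_(i in S) e i)%SET.
have [A0|[a aA]] := set_0Vmem A.
  by exists (fun=> u0); split=> [i j|i]; rewrite A0 inE.
(* Halmos-Vaughan: if some proper nonempty S has exactly #|S| neighbours, match
   S and its complement separately; otherwise one edge can be chosen freely. *)
have [[S /and3P[SA /andP[S0 SltA] /eqP NS]]|notight] :=
  pselect (exists S : {set T},
    [&& S \subset A, (0 < #|S| < #|A|)%N & #|N S| == #|S|]).
- have [f1 [f1inj f1e]] : exists f : T -> U,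
      {in S &, injective f} /\ {in S, forall i, f i \in e i}.
    apply: IH; first exact: leq_trans SltA leAm.
    by move=> S' S'S; apply: hallA; exact: fintype.subset_trans S'S SA.
  have [f2 [f2inj f2e]] : exists f : T -> U, {in A :\: S &, injective f} /\
      {in A :\: S, forall i, f i \in (e i :\: N S)}.
    apply: IH.
      by rewrite cardsDS// (leq_trans _ leAm)// ltn_subrL S0 (leq_trans _ SltA).
    move=> S' S'AS; have S'A : S' \subset A.
      exact: fintype.subset_trans S'AS (finset.subsetDl _ _).
    have S'S : [disjoint S' & S].
      apply/pred0P => x /=; apply/negP => /andP[/(fintype.subsetP S'AS)].
      by rewrite inE => /andP[/negP].
    (* Hall's condition for the union of [S'] and [S], less the equality for [S], is Hall's
       condition for [S'] with the neighbours in [N S] removed. *)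
    have : (#|S'| + #|S| <= #|N (S' :|: S)|)%N.
      rewrite -(eqP (etrans (leq_card_setU S' S).2 S'S)).
      by apply: hallA; rewrite finset.subUset S'A.
    rewrite -NS addnC -leq_subRL; last first.
      by apply: subset_leq_card; apply/fintype.subsetP => x /bigcupP[i iS xi];
        apply/bigcupP; exists i => //; rewrite inE iS orbT.
    move/leq_trans; apply.
    rewrite -cardsDS; last first.
      by apply/fintype.subsetP => x /bigcupP[i iS xi];
        apply/bigcupP; exists i => //; rewrite inE iS orbT.
    apply: subset_leq_card; apply/fintype.subsetP => x; rewrite inE.
    move=> /andP[xNS /bigcupP[i]]; rewrite inE => /orP[iS'|iS] xi.
      by apply/bigcupP; exists i => //; rewrite inE xNS.
    by case/negP: xNS; apply/bigcupP; exists i.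
  have N1 i : i \in S -> f1 i \in N S by move=> iS; apply/bigcupP; exists i; auto.
  exists (fun i => if i \in S then f1 i else f2 i); split=> [i j iA jA|i iA].
    case: ifPn => iS; case: ifPn => jS E.
    + exact: f1inj.
    + have : f2 j \in e j :\: N S by apply: f2e; rewrite inE jS.
      by rewrite inE -E N1.
    + have : f2 i \in e i :\: N S by apply: f2e; rewrite inE iS.
      by rewrite inE E N1.
    + by apply: f2inj => //; rewrite inE ?iS ?jS.
  case: ifPn => iS; first exact: f1e.
  by have : f2 i \in e i :\: N S by [apply: f2e; rewrite inE iS]; rewrite inE => /andP[].
have [u ua] : exists u, u \in e a.
  have /hallA : [set a]%SET \subset A by rewrite finset.sub1set.
  rewrite big_set1 cards1 card_gt0 => /set0Pn; exact.
have [f [finj fe]] : exists f : T -> U, {in A :\ a &, injective f} /\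
    {in A :\ a, forall i, f i \in e i :\ u}.
  apply: IH; first by rewrite (leq_trans _ leAm)// [X in (_ < X)%N](cardsD1 a) aA.
  move=> S SA; have [->|S0] := posnP #|S|; first by [].
  have SA' : S \subset A := fintype.subset_trans SA (finset.subsetDl _ _).
  have SltA : (#|S| < #|A|)%N.
    by rewrite [X in (_ < X)%N](cardsD1 a) aA ltnS subset_leq_card.
  (* A nonempty [S] avoiding [a] is proper in [A], hence not tight, and can afford to lose the
     neighbour [u]. *)
  have : (#|S| < #|N S|)%N.
    rewrite ltn_neqAle hallA// andbT; apply/negP => /eqP E.
    by apply: notight; exists S; rewrite SA' S0 SltA E eqxx.
  rewrite (cardsD1 u) => /leq_trans/(_ (leq_add (leq_b1 _) (leqnn _))).
  rewrite ltnS => /leq_trans; apply.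
  apply: subset_leq_card; apply/fintype.subsetP => x.
  rewrite !inE => /andP[xu /bigcupP[i iS xi]].
  by apply/bigcupP; exists i => //; rewrite !inE xu.
exists (fun i => if i == a then u else f i); split=> [i j iA jA|i iA].
  case: eqVneq => [->|ia]; case: eqVneq => [->|ja] //= E.
  - by have := fe j; rewrite !inE ja jA => /(_ isT)/andP[]; rewrite -E eqxx.
  - by have := fe i; rewrite !inE ia iA => /(_ isT)/andP[]; rewrite -E eqxx.
  - by apply: finj => //; rewrite !inE ?ia ?ja.
case: eqVneq => [->//|ia].
by have := fe i; rewrite !inE ia iA => /(_ isT)/andP[].
Qed.

Local Open Scope ring_scope.

(** Hall's condition holds for the support of [L]: the rows in [S] carry mass [s * #|S|], all of it
    in the columns of [N], whose total mass is [s * #|N|]. *)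
Lemma doubly_stochastic_matching (R : realFieldType) (n : nat) (L : 'M[R]_n.+1)
    (s : R) : 0 < s ->
  (forall i j, 0 <= L i j) ->
  (forall i, \sum_j L i j = s) -> (forall j, \sum_i L i j = s) ->
  exists p : 'S_n.+1, forall i, 0 < L i (p i).
Proof.
move=> s0 L0 Lr Lc; pose e i := [set j | 0 < L i j]%SET.
have hallL (S : {set 'I_n.+1}) : S \subset [set: 'I_n.+1]%SET ->
    (#|S| <= #|\bigcup_(i in S) e i|)%N.
  move=> _; set N := (\bigcup_(i in S) e i)%SET.
  rewrite -(ler_nat R) -(ler_pM2l s0) !mulr_natr -!sumr_const.
  rewrite -(eq_bigr _ (fun i _ => Lr i)) -(eq_bigr _ (fun j _ => Lc j)).
  rewrite [leRHS]exchange_big/= [leRHS](bigID (mem S))/=.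
  rewrite -[leLHS]addr0 lerD ?sumr_ge0//; last by move=> i _; rewrite sumr_ge0.
  apply: ler_sum => i iS; rewrite (bigID (mem N))/= [X in _ + X]big1 ?addr0//.
  move=> j; apply: contraNeq => Lij; apply/bigcupP; exists i => //.
  by rewrite inE lt_neqAle eq_sym Lij L0.
have [f [finj fe]] := hall_marriage ord0 hallL.
have {}finj : injective f by move=> i j; apply: finj; rewrite inE.
exists (perm finj) => i; rewrite permE.
by have := fe i; rewrite !inE; exact.
Qed.

Lemma birkhoff (R : realFieldType) (n : nat) (L : 'M[R]_n.+1) :
  (forall i j, 0 <= L i j) ->
  (forall i, \sum_j L i j = 1) -> (forall j, \sum_i L i j = 1) ->
  exists c : 'S_n.+1 -> R, [/\ forall p, 0 <= c p, \sum_p c p = 1 &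
    forall i j, L i j = \sum_(p : 'S_n.+1 | p i == j) c p].
Proof.
(* The weights sum to 1 because each permutation contributes to exactly one entry of row [ord0]. *)
move=> L0 Lr Lc; suff [c c0 cL] : exists2 c : 'S_n.+1 -> R,
    forall p, 0 <= c p & forall i j, L i j = \sum_(p : 'S_n.+1 | p i == j) c p.
  exists c; split=> //; rewrite -(Lr ord0).
  under [RHS]eq_bigr do rewrite cL.
  by rewrite (partition_big (fun p : 'S_n.+1 => p ord0) xpredT).
(* The line sum becomes a parameter, as it decreases when a multiple of a permutation matrix is
   removed. The induction is on the number of nonzero entries. *)
move: 1 Lr Lc => s.
have [m] := ubnP #|[set ij : 'I_n.+1 * 'I_n.+1 | L ij.1 ij.2 != 0]%SET|.
elim: m L L0 s => // m IH L L0 s; rewrite ltnS => Lm Lr Lc.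
have : 0 <= s by rewrite -(Lr ord0) sumr_ge0.
rewrite le_eqVlt => /predU1P[s0|s0].
  exists (fun=> 0) => // i j; rewrite big1_eq; apply/eqP.
  by move: (Lr i) j => /eqP; rewrite -s0 psumr_eq0// => /allP + j; apply;
    rewrite mem_index_enum.
have [p Lp] := doubly_stochastic_matching s0 L0 Lr Lc.
(* The least entry along [p] is the largest multiple of its permutation matrix that can be removed
   keeping all entries nonnegative; the entry in row [i0] then vanishes. *)
have [i0 _ i0min] := @arg_minP _ _ _ ord0 xpredT (fun i => L i (p i)) isT.
pose t := L i0 (p i0); pose L' : 'M[R]_n.+1 := \matrix_(i, j) (L i j - t *+ (p i == j)).
have [||||c c0 cL] := IH L' _ (s - t).
- move=> i j; rewrite mxE; case: eqVneq => [<-|_]; rewrite ?subr0//.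
  by rewrite subr_ge0 i0min.
- apply: leq_trans Lm; apply: proper_card; apply/properP; split.
    apply/fintype.subsetP => -[i j]; rewrite !inE/= mxE.
    by case: (p i =P j) => [<- _|_]; rewrite ?(lt0r_neq0 (Lp i)) ?subr0.
  exists (i0, p i0); rewrite !inE/= ?mxE ?eqxx ?subrr ?negbK ?eqxx//.
  by rewrite (lt0r_neq0 (Lp _)).
- move=> i; under eq_bigr do rewrite mxE; rewrite sumrB Lr; congr (_ - _).
  by rewrite (bigD1 (p i))//= eqxx big1 ?addr0// => j; rewrite eq_sym => /negbTE ->.
- move=> j; under eq_bigr do rewrite mxE; rewrite sumrB Lc; congr (_ - _).
  rewrite (bigD1 ((p^-1)%g j))//= permKV eqxx big1 ?addr0// => i.
  by case: (p i =P j) => // <-; rewrite permK eqxx.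
exists (fun q => c q + t *+ (q == p)).
  by move=> q; rewrite addr_ge0// mulrn_wge0// ltW// /t Lp.
move=> i j; rewrite big_split/= -cL mxE; case: eqVneq => [pij|pij].
  rewrite (bigD1 p) ?pij//= eqxx big1 ?addr0 ?subrK//.
  by move=> q /andP[_ /negbTE ->].
rewrite subr0 big1 ?addr0// => q /eqP qij; case: eqVneq => // qp.
by rewrite -qp qij eqxx in pij.
Qed.

Local Open Scope classical_set_scope.

(** * Atomless measures take all intermediate values *)

Lemma fine_probabilityE d (T : measurableType d) (R : realType)
    (P : probability T R) (A : set T) :
  measurable A -> P A = (fine (P A))%:E.
Proof. by move=> mA; rewrite fineK// fin_num_measure. Qed.

Lemma fine_probabilityD d (T : measurableType d) (R : realType)
    (P : probability T R) (A B : set T) :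
  measurable A -> measurable B -> B `<=` A ->
  fine (P (A `\` B)) = fine (P A) - fine (P B).
Proof.
move=> mA mB BA; rewrite measureD ?setIidr//.
- by rewrite fineB// fin_num_measure.
- by rewrite ltey_eq fin_num_measure.
Qed.

Lemma fine_probability_le d (T : measurableType d) (R : realType)
    (P : probability T R) (A B : set T) :
  measurable A -> measurable B -> A `<=` B -> fine (P A) <= fine (P B).
Proof.
by move=> mA mB AB; rewrite fine_le ?fin_num_measure// le_measure ?inE.
Qed.

(** If [B] is a part of [C] with measure strictly between 0 and that of [C], then [B] or its
    complement in [C] has at most half the measure; halving is then iterated. *)
Lemma atomless_small d (T : measurableType d) (R : realType)
    (P : probability T R) (A : set T) (e : R) :
  atomless P -> measurable A -> 0 < fine (P A) -> 0 < e ->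
  exists B, [/\ measurable B, B `<=` A & 0 < fine (P B) < e].
Proof.
move=> aP mA A0 e0.
have half C : measurable C -> 0 < fine (P C) -> exists B,
    [/\ measurable B, B `<=` C & 0 < fine (P B) <= fine (P C) / 2].
  move=> mC C0; have [|B [mB BC B0 BltC]] := aP C mC.
    by rewrite fine_probabilityE// lte_fin.
  move: B0 BltC; rewrite (fine_probabilityE _ mB) (fine_probabilityE _ mC).
  rewrite !lte_fin => B0 BltC.
  have [Bh|Bh] := leP (fine (P B)) (fine (P C) / 2).
    by exists B; split=> //; rewrite B0.
  exists (C `\` B); split; [exact: measurableD|exact: subDsetl|].
  rewrite fine_probabilityD//; lra.
have iter_half k : exists B,
    [/\ measurable B, B `<=` A & 0 < fine (P B) <= fine (P A) / 2 ^+ k].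
  elim: k => [|k [B [mB BA /andP[B0 Bk]]]].
    by exists A; split=> //; rewrite A0 expr0 divr1 lexx.
  have [C [mC CB /andP[C0 Ck]]] := half B mB B0.
  exists C; split => //; first exact: subset_trans CB BA.
  rewrite C0 (le_trans Ck)// exprSr invfM mulrA ler_pM2r ?invr_gt0//.
(* For this [k], [2 ^+ k > k > fine (P A) / e]. *)
have [B [mB BA /andP[B0 Bk]]] := iter_half (Num.bound (fine (P A) / e)).
exists B; split => //; rewrite B0 (le_lt_trans Bk)//.
rewrite ltr_pdivrMr ?exprn_gt0// mulrC -ltr_pdivrMr//.
have /archi_boundP/lt_trans : 0 <= fine (P A) / e by rewrite divr_ge0// ltW.
by apply; rewrite -natrX ltr_nat ltn_expl.
Qed.

Lemma sierpinski d (T : measurableType d) (R : realType)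
    (P : probability T R) (A : set T) (t : R) :
  atomless P -> measurable A -> 0 <= t <= fine (P A) ->
  exists B, [/\ measurable B, B `<=` A & P B = t%:E].
Proof.
move=> aP mA /andP[t0 tA].
(* Greedy construction: [f B] has at least half the largest measure among the
   sets that can still be added to [B]; as the total measure is finite, nothing
   of positive measure can be added to the union. *)
pose adm (B C : set T) :=
  [/\ measurable C, C `<=` A `\` B & fine (P C) <= t - fine (P B)].
pose good (B : set T) := [/\ measurable B, B `<=` A & fine (P B) <= t].
have P0 : P set0 = 0%E := measure0 P.
(* The premise [good B] stands under the existential so that [choice] gives a function on all sets,
   with default value [set0]. *)
have step B : exists C, good B ->
    adm B C /\ forall D, adm B D -> fine (P D) <= 2 * fine (P C).
  have [[mB BA Bt]|nB] := pselect (good B); last by exists set0.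
  pose S := [set fine (P D) | D in adm B].
  have S0 : S 0 by exists set0; [split=> //; rewrite P0/= subr_ge0|rewrite P0].
  have Sub : has_ubound S by exists (t - fine (P B)) => _ [D [_ _ +] <-].
  have Ssup : has_sup S by split; [exists 0|].
  (* If the supremum is not positive, all admissible sets are null and [set0] will do; otherwise
     some admissible [C] exceeds half of it. *)
  have [supS|supS] := leP (sup S) 0.
    exists set0 => _; split; first by split=> //; rewrite P0/= subr_ge0.
    by move=> D BD; rewrite P0/= mulr0 (le_trans _ supS)// ub_le_sup//; exists D.
  have [|_ [C BC <-] SC] := @sup_adherent _ S (sup S / 2) _ Ssup.
    by rewrite divr_gt0.
  exists C => _; split=> // D BD.
  have : fine (P D) <= sup S by rewrite ub_le_sup//; exists D.
  lra.
have [f fP] := choice step.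
pose F n := iter n (fun B => B `|` f B) set0.
have FS n : F n.+1 = F n `|` f (F n) by [].
have Fgood n : good (F n).
  elim: n => [|n IH]; first by split;
    [exact: measurable0|exact: sub0set|rewrite /F/= P0].
  have [[mC CA Ct] _] := fP _ IH; have [mF FA Ft] := IH.
  rewrite FS; split; [exact: measurableU|by rewrite subUset; split=> // x /CA[]|].
  rewrite measureU//; last by apply/seteqP; split=> // x [? /CA[]].
  by rewrite fineD ?fin_num_measure// -lerBrDl.
have mF n : measurable (F n) by have [] := Fgood n.
have mUF : measurable (\bigcup_n F n) by exact: bigcup_measurable.
have UFA : \bigcup_n F n `<=` A by apply: bigcup_sub => n _; have [] := Fgood n.
have Fcvg : (P \o F) x @[x --> \oo] --> P (\bigcup_n F n).
  apply: nondecreasing_cvg_mu => //; apply/nondecreasing_seqP => n.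
  by apply/subsetPset; rewrite FS; exact: subsetUl.
have UFt : (P (\bigcup_n F n) <= t%:E)%E.
  rewrite -(cvg_lim _ Fcvg)//; apply: lime_le.
    by apply/cvg_ex; exists (P (\bigcup_n F n)).
  by near=> n; have [_ _] := Fgood n;
    rewrite [in X in _ -> X]/= (fine_probabilityE _ (mF n)) lee_fin.
exists (\bigcup_n F n); split=> //; apply/eqP; rewrite eq_le UFt/= leNgt.
apply/negP; rewrite {1}fine_probabilityE// lte_fin => UFlt.
(* A deficit leaves room for a non-null [D] disjoint from every [F n] and small enough to be
   admissible at each stage. *)
have [|||D [mD DA /andP[D0 Dlt]]] :=
    @atomless_small _ _ _ P (A `\` \bigcup_n F n)
      (t - fine (P (\bigcup_n F n))) aP.
- exact: measurableD.
- by rewrite fine_probabilityD// subr_gt0 (lt_le_trans UFlt).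
- by rewrite subr_gt0.
have FU n : F n `<=` \bigcup_n F n by exact: bigcup_sup.
(* By near-maximality each stage gains at least half the measure of [D], so the measures of the
   [F n] would eventually exceed [t]. *)
have big n : n%:R * (fine (P D) / 2) <= fine (P (F n)).
  elim: n => [|n IH]; first by rewrite mul0r P0.
  have [[mC CA _] Cmax] := fP _ (Fgood n).
  have := Cmax D; rewrite FS measureU//; last by apply/seteqP; split=> // x [? /CA[]].
  rewrite fineD ?fin_num_measure// => DC.
  rewrite -natr1 mulrDl mul1r lerD// ler_pdivrMr// mulrC DC//; split=> //.
    by apply: subset_trans DA _ => x [Ax nx]; split=> // /FU.
  by rewrite (le_trans (ltW Dlt))// lerB// fine_probability_le.
have := big (Num.bound (t / (fine (P D) / 2))).
have [_ _ +] := Fgood (Num.bound (t / (fine (P D) / 2))) => /[swap] /le_trans /[apply].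
apply/negP; rewrite -ltNge -ltr_pdivrMr ?divr_gt0//.
by apply: archi_boundP; rewrite divr_ge0// ltW// divr_gt0.
Unshelve. all: by end_near. Qed.

(** * The space of bit sequences and its cylinders *)

(* Most recent bit first. *)
Fixpoint bit_prefix (b : nat -> bool) (k : nat) : seq bool :=
  if k is k'.+1 then b k' :: bit_prefix b k' else [::].

Definition cylinder (s : seq bool) : set (nat -> bool) :=
  [set b | bit_prefix b (size s) = s].

(** The empty set is included for closure under intersection: two cylinders are nested or
    disjoint. *)
Definition cylinders : set (set (nat -> bool)) :=
  [set A | A = set0 \/ exists s, A = cylinder s].

(* The product sigma-algebra on {0,1}^nat. *)
Notation cantor_space := (g_sigma_algebraType cylinders).

Lemma size_bit_prefix b k : size (bit_prefix b k) = k.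
Proof. by elim: k => //= k ->. Qed.

Lemma cylinder_bit_prefix b k : cylinder (bit_prefix b k) b.
Proof. by rewrite /cylinder/= size_bit_prefix. Qed.

Lemma bit_prefix_le (b b' : nat -> bool) (k l : nat) : (k <= l)%N ->
  bit_prefix b l = bit_prefix b' l -> bit_prefix b k = bit_prefix b' k.
Proof.
elim: l => [|l IH]; first by rewrite leqn0 => /eqP ->.
by rewrite leq_eqVlt ltnS => /predU1P[->//|kl] /= [_ /IH]; exact.
Qed.

Lemma cylinder_cons c s :
  cylinder (c :: s) = [set b | b (size s) = c] `&` cylinder s.
Proof.
apply/seteqP; split=> b; rewrite /cylinder/=; first by case=> -> ->.
by case=> -> ->.
Qed.

Lemma setI_closed_cylinders : setI_closed cylinders.
Proof.
move=> _ _ [->|[s ->]] [->|[s' ->]]; rewrite ?set0I ?setI0; try by left.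
wlog ss' : s s' / (size s <= size s')%N.
  by move=> W; have [/W //|/ltnW/W] := leqP (size s) (size s'); rewrite setIC.
have [[b [bs bs']]|none] := pselect (cylinder s `&` cylinder s' !=set0); last first.
  by left; apply/eqP/negPn/negP => /set0P.
right; exists s'; apply/setIidr => b' b's'.
rewrite /cylinder/= -[RHS]bs; apply: bit_prefix_le ss' _.
by rewrite [LHS]b's' [RHS]bs'.
Qed.

Lemma measurable_cylinder s : measurable (cylinder s : set cantor_space).
Proof. by apply: sub_sigma_algebra; right; exists s. Qed.

Lemma measurable_bit k : measurable_fun setT (fun b : cantor_space => b k).
Proof.
apply: (measurable_fun_bool true); rewrite setTI.
(* The words [s] of length [k] form a countable index set. *)
rewrite (_ : _ @^-1` _ = \bigcup_(s in [set s : seq bool | size s = k])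
   (cylinder (true :: s) : set cantor_space)).
  rewrite bigcup_mkcond; apply: countable_bigcupT_measurable => // s.
  by case: ifP => // _; exact: measurable_cylinder.
apply/seteqP; split=> b /=.
  move=> bk; exists (bit_prefix b k); first exact: size_bit_prefix.
  by rewrite cylinder_cons size_bit_prefix; split=> //; exact: cylinder_bit_prefix.
by move=> [s <-]; rewrite cylinder_cons => -[].
Qed.

(** Uniqueness of finite measures on a generating pi-system; the whole space is the cylinder of the
    empty word. *)
Lemma eq_measure_cantor (R : realType) (m1 m2 : {measure set cantor_space -> \bar R}) :
  (m1 setT < +oo)%E -> (forall s, m1 (cylinder s) = m2 (cylinder s)) ->
  forall A, measurable A -> m1 A = m2 A.
Proof.
have cyl0 : cylinder [::] = setT by apply/seteqP; split.
move=> m1oo m12 A mA.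
apply: (@measure_unique _ R cantor_space cylinders (fun=> setT)) => //.
- exact: setI_closed_cylinders.
- by move=> _; right; exists [::].
- by rewrite bigcup_const.
- by move=> _ [->|[s ->]]; [rewrite !measure0|exact: m12].
Qed.

(** * Realising laws on bit sequences *)

Lemma pushforward_measure d1 d2 (T1 : measurableType d1)
    (T2 : measurableType d2) (R : realType) (m : {measure set T1 -> \bar R})
    (f : T1 -> T2) : measurable_fun setT f ->
  exists nu : {measure set T2 -> \bar R}, forall A, nu A = m (f @^-1` A).
Proof.
by move=> mf; unshelve eexists (pushforward m f : {measure set T2 -> \bar R}).
Qed.

(** Words index a tree of events: [E s] has the measure of [cylinder s], and [H] cuts it into its
    two children. [D] sends [t] to the branch of events containing it, so the preimage of
    [cylinder s] is [E s], and cylinders determine the law. *)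
Lemma cantor_realization d (T : measurableType d) (R : realType)
    (P : probability T R) (nu : {measure set cantor_space -> \bar R}) :
  atomless P -> nu setT = 1%E ->
  exists2 D : T -> cantor_space, measurable_fun setT D &
    forall A, measurable A -> P (D @^-1` A) = nu A.
Proof.
move=> aP nu1.
have nufin s : nu (cylinder s) \is a fin_num.
  rewrite ge0_fin_numE// (@le_lt_trans _ _ 1%E) ?ltry// -nu1.
  by rewrite le_measure ?inE//; exact: measurable_cylinder.
have nuD s : nu (cylinder s) =
    (nu (cylinder (true :: s)) + nu (cylinder (false :: s)))%E.
  rewrite -measureU; [|exact: measurable_cylinder..|].
    congr (nu _); apply/seteqP; split=> b.
      by move=> bs; case E : (b (size s)); [left|right]; rewrite cylinder_cons.
    by rewrite !cylinder_cons => -[] [].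
  by apply/seteqP; split=> // b; rewrite !cylinder_cons => -[[/= -> _] []].
(* Sierpinski's theorem selects the [true] child; its complement in the parent gets the right
   measure by [nuD]. *)
have /choice[H HP] : forall As : set T * seq bool, exists B,
    measurable As.1 -> P As.1 = nu (cylinder As.2) ->
    [/\ measurable B, B `<=` As.1 & P B = nu (cylinder (true :: As.2))].
  move=> [A s] /=.
  have [[mA PA]|nA] := pselect (measurable A /\ P A = nu (cylinder s)); last first.
    by exists set0 => mA PA; case: nA.
  have [|B [mB BA PB]] := @sierpinski _ _ _ P A (fine (nu (cylinder (true :: s)))) aP mA.
    rewrite fine_ge0//= PA nuD fine_le ?leeDl//.
    by rewrite fin_numD !nufin.
  by exists B => _ _; split=> //; rewrite PB fineK.
pose fix E s := if s is b :: s' then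
    if b then H (E s', s') else E s' `\` H (E s', s') else setT.
have EP s : measurable (E s) /\ P (E s) = nu (cylinder s).
  elim: s => [|b s [mE PE]].
    split=> //=; rewrite probability_setT -nu1; congr (nu _).
    by apply/seteqP; split.
  have [mH HE PH] := HP (E s, s) mE PE.
  case: b => /=; first by split.
  split; first exact: measurableD.
  rewrite measureD ?setIidr//; last by rewrite ltey_eq fin_num_measure.
  transitivity (nu (cylinder s) - nu (cylinder (true :: s)))%E.
    by congr (_ - _)%E.
  by rewrite nuD addeAC subee ?add0e.
have HE s : H (E s, s) `<=` E s by have [mE PE] := EP s; have [] := HP (E s, s) mE PE.
(* [path t k] is the word of length [k] reached by [t], and [t] lies in [E (path t k)] for every
   [k]. *)
pose fix path t k := if k is k'.+1 then
    `[< H (E (path t k'), path t k') t >] :: path t k' else [::].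
pose D (t : T) : cantor_space := fun k => `[< H (E (path t k), path t k) t >].
have pathD t k : bit_prefix (D t) k = path t k by elim: k => //= k ->.
have DE s : D @^-1` cylinder s = E s.
  apply/seteqP; split=> t.
    rewrite /= /cylinder/= pathD => <-; elim: (size s) => //= k IH.
    by case: asboolP.
  rewrite /= /cylinder/= pathD; elim: s => //= b s IH Ebs.
  have Es : E s t by case: b Ebs => [/HE|[]].
  rewrite IH//; congr cons; case: b Ebs => [Ht|[_ nHt]]; first exact/asboolP.
  exact/asboolPn.
have mD : measurable_fun setT D.
  apply: (@measurability _ _ T cantor_space setT D cylinders) => // _ [_ [->|[s ->]] <-].
    by rewrite preimage_set0 setI0.
  by rewrite setTI DE; have [] := EP s.
exists D => // A mA.
have [mu muE] := pushforward_measure P mD.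
rewrite -muE; apply: eq_measure_cantor => // [|s]; rewrite muE.
  rewrite preimage_setT [X in (X < _)%E](_ : _ = 1%E) ?ltry//.
  exact: probability_setT.
by rewrite DE; have [] := EP s.
Qed.

Lemma measurable_fun_cantor d (T : measurableType d) (f : T -> cantor_space) :
  (forall k, measurable_fun setT (fun t => f t k)) -> measurable_fun setT f.
Proof.
move=> mf; apply: (@measurability _ _ T cantor_space setT f cylinders) => //.
move=> _ [_ [->|[s ->]] <-]; first by rewrite preimage_set0 setI0.
rewrite setTI; elim: s => [|b s IH].
  by rewrite (_ : cylinder _ = setT) ?preimage_setT//; apply/seteqP; split.
rewrite cylinder_cons preimage_setI; apply: measurableI => //.
rewrite -[X in measurable X]setTI.
exact: (mf (size s) measurableT [set b]).
Qed.

(** * Coding real vectors by bit sequences *)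

(* Bit [k] of the code of [x] tells whether [x_i <= q], where [k] encodes
   [(i, q)]; [x_i] is the infimum of the [q] whose bit is set. *)
Definition cut_index (n k : nat) : option ('I_n * rat) := unpickle k.

Definition cut_code (R : realType) (n : nat) (x : n.-tuple R) : cantor_space :=
  fun k => if cut_index n k is Some (i, q) then tnth x i <= ratr q else false.

(** The value [+oo] is neutral for the infimum: it is taken when bit [k] is unset or does not
    concern coordinate [i]. *)
Definition cut_bound (R : realType) (n : nat) (i : 'I_n) (b : cantor_space)
    (k : nat) : \bar R :=
  if cut_index n k is Some (j, q) then
    if b k && (j == i) then (ratr q)%:E else +oo%E
  else +oo%E.

(** [einfs] at 0 is the infimum over all [k]. It may be infinite on sequences that code no vector,
    where [fine] returns 0. *)
Definition cut_decode (R : realType) (n : nat) (b : cantor_space) : n.-tuple R :=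
  [tuple fine (einfs (cut_bound R i b) 0) | i < n].

Lemma cut_codeK (R : realType) (n : nat) :
  cancel (@cut_code R n) (@cut_decode R n).
Proof.
move=> x; apply: eq_from_tnth => i; rewrite tnth_mktuple.
rewrite -[RHS]/(fine (tnth x i)%:E); congr fine.
apply/eqP; rewrite eq_le; apply/andP; split.
  (* By density of the rationals, some set bit belongs to a [q] below [tnth x i + e]. *)
  apply/lee_addgt0Pr => e e0; rewrite -EFinD.
  have /rat_in_itvoo[q] : tnth x i < tnth x i + e by rewrite ltrDl.
  rewrite in_itv/= => /andP[xq qe].
  apply: (@le_trans _ _ (ratr q)%:E); last by rewrite lee_fin ltW.
  apply: ereal_inf_lbound; exists (pickle (i, q)) => //.
  by rewrite /cut_bound /cut_code /cut_index pickleK eqxx (ltW xq).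
apply: le_ereal_inf_tmp => _ [k _ <-]; rewrite /cut_bound /cut_code.
case: cut_index => [[j q]|]; last by rewrite leey.
by case: ifPn => [/andP[xq /eqP <-]|_]; rewrite ?lee_fin ?leey.
Qed.

Lemma measurable_cut_code (R : realType) (n : nat) :
  measurable_fun setT (@cut_code R n).
Proof.
apply: measurable_fun_cantor => k; rewrite /cut_code.
case: cut_index => [[i q]|]; last exact: measurable_cst.
apply: measurable_fun_ler; last exact: measurable_cst.
exact: measurable_tnth.
Qed.

Lemma measurable_cut_decode (R : realType) (n : nat) :
  measurable_fun setT (@cut_decode R n).
Proof.
apply/measurable_fun_tnthP => i.
rewrite (_ : _ \o _ = fine \o (fun b => einfs (cut_bound R i b) 0)); last first.
  by apply/funext => b; rewrite /= tnth_mktuple.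
apply: measurableT_comp; first exact: fine_measurable.
apply: measurable_fun_einfs => k; rewrite /cut_bound.
case: cut_index => [[j q]|]; last exact: measurable_cst.
apply: measurable_fun_ifT; [|exact: measurable_cst..].
by apply: measurable_and; [exact: measurable_bit|exact: measurable_cst].
Qed.

(** The image of [nu] under the code is realised on bit sequences, then decoded; decoding undoes
    coding, so the law obtained is [nu]. *)
Lemma tuple_realization d (T : measurableType d) (R : realType)
    (P : probability T R) (n : nat)
    (nu : {measure set (n.-tuple R) -> \bar R}) :
  atomless P -> nu setT = 1%E ->
  exists2 Y : T -> n.-tuple R, measurable_fun setT Y &
    forall A, measurable A -> P (Y @^-1` A) = nu A.
Proof.
move=> aP nu1.
have [mu muE] := pushforward_measure nu (@measurable_cut_code R n).
have [|D mD DE] := @cantor_realization _ _ _ P mu aP.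
  by rewrite muE preimage_setT.
exists (@cut_decode R n \o D).
  by apply: measurableT_comp => //; exact: measurable_cut_decode.
move=> A mA; rewrite comp_preimage DE ?muE.
  by congr (nu _); apply/seteqP; split=> x; rewrite /= cut_codeK.
by rewrite -[X in measurable X]setTI; exact: measurable_cut_decode.
Qed.

(** * Mixtures of laws and the inclusion *)

Lemma mixture_measure d (T : measurableType d) (R : realType) (I : finType)
    (i0 : I) (c : I -> R) (m : I -> {measure set T -> \bar R}) :
  (forall i, 0 <= c i) ->
  exists nu : {measure set T -> \bar R},
    forall A, nu A = (\sum_i (c i)%:E * m i A)%E.
Proof.
move=> c0; pose e k := nth i0 (index_enum I) k.
exists (msum (fun k => mscale (NngNum (c0 (e k))) (m (e k)))
  (size (index_enum I))).
by move=> A; rewrite [RHS](big_nth i0) big_mkord.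
Qed.

Lemma Dset_mixF d (T : measurableType d) (R : realType) (P : probability T R)
    (n : nat) (f : n.-tuple R -> R) (F : 'I_n -> R -> R) (L : 'M[R]_n) :
  atomless P -> measurable_fun setT f -> symmetric_fun f ->
  doubly_stochastic L -> Dset P f F `<=` Dset P f (mixF L F).
Proof.
(* In dimension 0 both tuples of cdfs are the function on an empty type; Birkhoff's theorem is
   stated for positive dimension. *)
case: n f F L => [|n] f F L aP mf sf [L0 Lr Lc].
  by rewrite (_ : mixF L F = F)//; apply/funext => -[].
move=> _ [X [XF ->]].
have [c [c0 c1 cL]] := birkhoff L0 Lr Lc.
pose XS (s : 'S_n.+1) w := [tuple X (s i) w | i < n.+1].
have mXS s : measurable_fun setT (XS s).
  apply/measurable_fun_tnthP => i.
  rewrite (_ : _ \o _ = X (s i)); last by apply/funext => w; rewrite /= tnth_mktuple.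
  by have [] := XF (s i).
have /choice[m mE] s := pushforward_measure P (mXS s).
have [nu nuE] := mixture_measure 1%g m c0.
have [|Y mY YE] := @tuple_realization _ _ _ P _ nu aP.
  rewrite nuE -c1 -sumEFin; apply: eq_bigr => s _; rewrite mE preimage_setT.
  by rewrite -[RHS]mule1; congr (_ * _)%E; exact: probability_setT.
have preim_le (g : n.+1.-tuple R -> R) r : measurable_fun setT g ->
    measurable [set x | g x <= r].
  move=> mg; rewrite (_ : mkset _ = setT `&` g @^-1` `]-oo, r]).
    exact: mg.
  by rewrite setTI; apply/seteqP; split=> x; rewrite /= in_itv.
(* This is used twice: for coordinates, to get the marginals, and for [f]. *)
have law (g : n.+1.-tuple R -> R) r : measurable_fun setT g ->
    cdf_of P (g \o Y) r = \sum_s c s * cdf_of P (g \o XS s) r.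
  move=> mg; rewrite /cdf_of.
  rewrite [P _](YE [set x | g x <= r] (preim_le _ _ mg)) nuE.
  rewrite -[RHS]/(fine (_)%:E) -sumEFin; congr fine; apply: eq_bigr => s _.
  rewrite mE EFinM; congr (_ * _)%E.
  rewrite -fine_probabilityE// -[X in measurable X]setTI.
  exact: (mXS s measurableT _ (preim_le g r mg)).
exists (fun i w => tnth (Y w) i); split=> [i|].
  split; first by move/measurable_fun_tnthP : mY; exact.
  apply/funext => r; rewrite (law (fun x => tnth x i)); last exact: measurable_tnth.
  (* Grouping the permutations by [j = s i], the weights of each group add up to [L i j]. *)
  rewrite /mixF (partition_big (fun s : 'S_n.+1 => s i) xpredT)//=.
  apply: eq_bigr => j _; rewrite cL mulr_suml; apply: eq_bigr => s /eqP sij.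
  have [_ <-] := XF j; rewrite -sij; congr (_ * cdf_of _ _ _).
  by apply/funext => w; rewrite /= tnth_mktuple.
apply/funext => r.
rewrite (_ : (fun w => f [tuple tnth (Y w) i | i < n.+1]) = f \o Y); last first.
  by apply/funext => w /=; congr f; apply: eq_from_tnth => i; rewrite tnth_mktuple.
(* By symmetry each term has the cdf of [f] at the original [X], and the weights sum to 1. *)
rewrite law// -[LHS]mul1r -c1 mulr_suml; apply: eq_bigr => s _.
congr (_ * cdf_of _ _ _); apply/funext => w /=.
rewrite (sf _ s); congr f; apply: eq_from_tnth => i.
by rewrite !tnth_mktuple.
Qed.

Lemma symmetric_sumf (R : realType) (n : nat) : symmetric_fun (@sumf R n).
Proof.
move=> x s; rewrite /sumf (reindex_inj (@perm_inj _ s))/=.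
by apply: eq_bigr => i _; rewrite tnth_mktuple.
Qed.

Lemma measurable_sumf (R : realType) (n : nat) : measurable_fun setT (@sumf R n).
Proof. by apply: measurable_sum => i; exact: measurable_tnth. Qed.

Theorem theorem2 (d : measure_display) (T : measurableType d) (R : realType)
  (P : probability T R) (hP : atomless P)
  (n : nat) (f : n.-tuple R -> R)
  (mf : measurable_fun setT f) (sf : symmetric_fun f)
  (F : 'I_n -> R -> R) (hF : forall i, is_cdf (F i))
  (L : 'M[R]_n) (hL : doubly_stochastic L) :
  Dset P f F `<=` Dset P f (mixF L F) /\
  Dsum P F `<=` Dsum P (mixF L F).
Proof.
split; apply: Dset_mixF => //; [exact: measurable_sumf|exact: symmetric_sumf].
Qed.
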